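(* Let $t=-2$, let $s\in\mathbb{C}$, and let $\mathcal{B}=\mathcal{Y}(\mathfrak g,\mathfrak g)\subset\mathcal{Y}(\mathfrak g)$, $\mathfrak g=\mathfrak{sl}(2)$, be the twisted Yangian of type II, i.e. the left coideal subalgebra generated by $E^\pm,H$ and $$\widetilde{\widetilde E}{}^\pm=\pm\frac12\Big([\widehat H,\widehat E^\pm]+\alpha\big(\pm t\,\widehat E^\pm+H\widehat E^\pm-E^\pm\widehat H\big)\Big),\qquad \widetilde{\widetilde H}=[\widetilde{\widetilde E}{}^+,E^-].$$ Then $\mathcal{B}$ is a reflection algebra for a vector boundary: the intertwining equation $$(T_{-u}\otimes T_s)[\Delta(b)]\,K(u)=K(u)\,(T_u\otimes T_s)[\Delta(b)]\qquad\text{for all }b\in\mathcal{B}$$ determines a nonzero $4\times4$ matrix $K(u)\in\mathrm{End}(\mathcal V\otimes\mathcal W)$ (with entries in $\mathbb{C}(u)$), uniquely up to an overall scalar factor, and this $K(u)$ satisfies the reflection equation $$R_{12}(u-v)\,K_{13}(u)\,R_{12}(u+v)\,K_{23}(v)=K_{23}(v)\,R_{12}(u+v)\,K_{13}(u)\,R_{12}(u-v)$$ on $\mathcal V\otimes\mathcal V\otimes\mathcal W$, $\mathcal V=\mathcal W=\mathbb{C}^2$, subscripts indicating the tensor factors acted on.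
   Context: $\mathcal{Y}(\mathfrak{sl}(2))$ is Drinfeld's Yangian (first realization) with formal deformation parameter $\alpha$, generated by $E^\pm,H$ and $\widehat E^\pm,\widehat H$ with $[H,E^\pm]=\pm2E^\pm$, $[E^+,E^-]=H$, $[H,\widehat E^\pm]=[\widehat H,E^\pm]=\pm2\widehat E^\pm$, $[E^\pm,\widehat E^\mp]=\pm\widehat H$, $[H,\widehat H]=0$, $[E^\pm,\widehat E^\pm]=0$, and Drinfeld's Serre-type relation for $\mathfrak{sl}(2)$. Coproduct: $\Delta(x)=x\otimes1+1\otimes x$ for $x\in\{E^\pm,H\}$, $\Delta(\widehat H)=\widehat H\otimes1+1\otimes\widehat H-\alpha(E^+\otimes E^--E^-\otimes E^+)$, $\Delta(\widehat E^\pm)=\widehat E^\pm\otimes1+1\otimes\widehat E^\pm\pm\frac{\alpha}{2}(E^\pm\otimes H-H\otimes E^\pm)$. Fundamental evaluation representation on $\mathbb{C}^2$: $T_u(E^+)=e_{1,2}$, $T_u(E^-)=e_{2,1}$, $T_u(H)=e_{1,1}-e_{2,2}$, $T_u(\widehat X)=u\,T_u(X)$ for $X=E^\pm,H$, and $T_u(\alpha)=1$. The boundary representation $T_s$ on $\mathcal W$ is the same with $u$ replaced by $s$. $R$-matrix in the basis $v_1\otimes v_1,v_1\otimes v_2,v_2\otimes v_1,v_2\otimes v_2$: $$R(u)=\begin{pmatrix}1&0&0&0\\0&r&1-r&0\\0&1-r&r&0\\0&0&0&1\end{pmatrix},\qquad r=\frac{u}{u-1}.$$ All identities are identities of rational functions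 in $u,v$. *)

(* Defs.v *)
From HB Require Import structures.
From mathcomp Require Import all_boot all_order all_algebra.
From mathcomp Require Import boolp reals mxtens complex.

Set Implicit Arguments.
Unset Strict Implicit.
Unset Printing Implicit Defensive.

Import GRing.Theory Num.Theory.
Local Open Scope ring_scope.
Local Open Scope quotient_scope.

Inductive term (K X : Type) : Type :=
  | Gen of X
  | Scal of K
  | Add of term K X & term K X
  | Mul of term K X & term K X.
Arguments Gen {K X}.
Arguments Scal {K X}.
Arguments Add {K X}.
Arguments Mul {K X}.

HB.instance Definition _ (K X : Type) := gen_eqMixin (term K X).
HB.instance Definition _ (K X : Type) := gen_choiceMixin (term K X).

Fixpoint eval (K X : Type) (A : pzRingType) (sigma : K -> A) (g : X -> A)
    (p : term K X) : A :=
  match p with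
  | Gen x => g x
  | Scal k => sigma k
  | Add p q => eval sigma g p + eval sigma g q
  | Mul p q => eval sigma g p * eval sigma g q
  end.

Section Presented.
Variables (K : comNzRingType) (X : Type).
Variable prel : term K X -> term K X -> Prop.

(* The least congruence that contains [prel] and the axioms of an associative
   unital K-algebra; the opposite of [p] is [(-1) p]. *)
Inductive teq : term K X -> term K X -> Prop :=
  | teq_rel p q : prel p q -> teq p q
  | teq_refl p : teq p p
  | teq_sym p q : teq p q -> teq q p
  | teq_trans p q r : teq p q -> teq q r -> teq p r
  | teq_add p p' q q' : teq p p' -> teq q q' -> teq (Add p q) (Add p' q')
  | teq_mul p p' q q' : teq p p' -> teq q q' -> teq (Mul p q) (Mul p' q')
  | teq_addA p q r : teq (Add p (Add q r)) (Add (Add p q) r)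
  | teq_addC p q : teq (Add p q) (Add q p)
  | teq_add0 p : teq (Add (Scal 0) p) p
  | teq_mul0 p : teq (Mul (Scal 0) p) (Scal 0)
  | teq_mulA p q r : teq (Mul p (Mul q r)) (Mul (Mul p q) r)
  | teq_mul1 p : teq (Mul (Scal 1) p) p
  | teq_mulDl p q r : teq (Mul (Add p q) r) (Add (Mul p r) (Mul q r))
  | teq_mulDr p q r : teq (Mul p (Add q r)) (Add (Mul p q) (Mul p r))
  | teq_scalD k l : teq (Scal (k + l)) (Add (Scal k) (Scal l))
  | teq_scalM k l : teq (Scal (k * l)) (Mul (Scal k) (Scal l))
  | teq_scalC k p : teq (Mul (Scal k) p) (Mul p (Scal k)).

Definition teqb : rel (term K X) := fun p q => `[< teq p q >].

Lemma teqb_refl : reflexive teqb.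
Proof. by move=> p; apply/asboolP/teq_refl. Qed.
Lemma teqb_sym : symmetric teqb.
Proof. by move=> p q; apply/asboolP/asboolP => /teq_sym. Qed.
Lemma teqb_trans : transitive teqb.
Proof.
by move=> q p r /asboolP pq /asboolP qr; apply/asboolP; apply: teq_trans qr.
Qed.
Canonical teqb_equiv := EquivRel teqb teqb_refl teqb_sym teqb_trans.

Definition presented : Type := {eq_quot teqb_equiv}.
HB.instance Definition _ := Choice.on presented.
HB.instance Definition _ := EqQuotient.on presented.

Definition cls (p : term K X) : presented := \pi_presented p.

Lemma cls_eq p q : teq p q -> cls p = cls q.
Proof. by move=> pq; apply/eqquotP/asboolP. Qed.
Lemma teq_cls p q : cls p = cls q -> teq p q.
Proof. by move/eqquotP/asboolP. Qed.
Lemma cls_repr x : cls (repr x) = x.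
Proof. exact: reprK. Qed.
Lemma clsW (P : presented -> Prop) : (forall p, P (cls p)) -> forall x, P x.
Proof. by move=> Pp x; rewrite -(cls_repr x). Qed.
Lemma repr_cls p : teq (repr (cls p)) p.
Proof. by apply: teq_cls; rewrite cls_repr. Qed.

Definition padd (x y : presented) := cls (Add (repr x) (repr y)).
Definition pmul (x y : presented) := cls (Mul (repr x) (repr y)).
Definition pscal (k : K) (x : presented) := cls (Mul (Scal k) (repr x)).
Definition popp := pscal (-1).

Lemma cls_add p q : padd (cls p) (cls q) = cls (Add p q).
Proof. by apply: cls_eq; apply: teq_add; apply: repr_cls. Qed.
Lemma cls_mul p q : pmul (cls p) (cls q) = cls (Mul p q).
Proof. by apply: cls_eq; apply: teq_mul; apply: repr_cls. Qed.
Lemma cls_scal k p : pscal k (cls p) = cls (Mul (Scal k) p).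
Proof.
by apply: cls_eq; apply: teq_mul; [apply: teq_refl | apply: repr_cls].
Qed.

Fact paddA : associative padd.
Proof.
elim/clsW=> p; elim/clsW=> q; elim/clsW=> r.
by rewrite !cls_add; apply/cls_eq/teq_addA.
Qed.
Fact paddC : commutative padd.
Proof.
by elim/clsW=> p; elim/clsW=> q; rewrite !cls_add; apply/cls_eq/teq_addC.
Qed.
Fact padd0 : left_id (cls (Scal 0)) padd.
Proof. by elim/clsW=> p; rewrite !cls_add; apply/cls_eq/teq_add0. Qed.
Fact paddN : left_inverse (cls (Scal 0)) popp padd.
Proof.
elim/clsW=> p; rewrite /popp cls_scal cls_add; apply: cls_eq.
apply: (teq_trans (q := Add (Mul (Scal (-1)) p) (Mul (Scal 1) p))).
  by apply: teq_add; [apply: teq_refl | apply/teq_sym/teq_mul1].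
apply: teq_trans (teq_sym (teq_mulDl _ _ _)) _.
apply: teq_trans (teq_mul0 p); apply: teq_mul; last exact: teq_refl.
by apply: teq_trans (teq_sym (teq_scalD _ _)) _; rewrite addNr; apply: teq_refl.
Qed.
HB.instance Definition _ :=
  GRing.isZmodule.Build presented paddA paddC padd0 paddN.

Fact pmulA : associative pmul.
Proof.
elim/clsW=> p; elim/clsW=> q; elim/clsW=> r.
by rewrite !cls_mul; apply/cls_eq/teq_mulA.
Qed.
Fact pmul1l : left_id (cls (Scal 1)) pmul.
Proof. by elim/clsW=> p; rewrite !cls_mul; apply/cls_eq/teq_mul1. Qed.
Fact pmul1r : right_id (cls (Scal 1)) pmul.
Proof.
elim/clsW=> p; rewrite !cls_mul; apply/cls_eq.
exact: teq_trans (teq_sym (teq_scalC _ _)) (teq_mul1 _).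
Qed.
Fact pmulDl : left_distributive pmul padd.
Proof.
elim/clsW=> p; elim/clsW=> q; elim/clsW=> r.
by rewrite !(cls_mul, cls_add); apply/cls_eq/teq_mulDl.
Qed.
Fact pmulDr : right_distributive pmul padd.
Proof.
elim/clsW=> p; elim/clsW=> q; elim/clsW=> r.
by rewrite !(cls_mul, cls_add); apply/cls_eq/teq_mulDr.
Qed.
HB.instance Definition _ :=
  GRing.Zmodule_isPzRing.Build presented pmulA pmul1l pmul1r pmulDl pmulDr.

Fact pscalA k l x : pscal k (pscal l x) = pscal (k * l) x.
Proof.
elim/clsW: x => p; rewrite !cls_scal; apply: cls_eq.
apply: teq_trans (teq_mulA _ _ _) _.
by apply: teq_mul; [apply/teq_sym/teq_scalM | apply: teq_refl].
Qed.
Fact pscal1 : left_id 1 pscal.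
Proof. by elim/clsW=> p; rewrite cls_scal; apply/cls_eq/teq_mul1. Qed.
Fact pscalDr : right_distributive pscal +%R.
Proof.
move=> k; elim/clsW=> p; elim/clsW=> q.
rewrite [cls p + _]cls_add !cls_scal [RHS]cls_add.
exact/cls_eq/teq_mulDr.
Qed.
Fact pscalDl x : {morph pscal^~ x : k l / k + l}.
Proof.
elim/clsW: x => p k l; rewrite /= !cls_scal [RHS]cls_add; apply: cls_eq.
apply: teq_trans (teq_mulDl _ _ _).
by apply: teq_mul; [apply: teq_scalD | apply: teq_refl].
Qed.
HB.instance Definition _ :=
  GRing.Zmodule_isLmodule.Build K presented pscalA pscal1 pscalDr pscalDl.

Fact pscalAl (k : K) (x y : presented) : k *: (x * y) = (k *: x) * y.
Proof.
elim/clsW: x => p; elim/clsW: y => q.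
rewrite [cls p * _]cls_mul [LHS]cls_scal [k *: _]cls_scal [RHS]cls_mul.
exact/cls_eq/teq_mulA.
Qed.
Fact pscalAr (k : K) (x y : presented) : k *: (x * y) = x * (k *: y).
Proof.
elim/clsW: x => p; elim/clsW: y => q.
rewrite [cls p * _]cls_mul [LHS]cls_scal [k *: _]cls_scal [RHS]cls_mul.
apply: cls_eq; apply: teq_trans (teq_mulA _ _ _) _.
apply: teq_trans (teq_sym (teq_mulA _ _ _)).
by apply: teq_mul; [apply: teq_scalC | apply: teq_refl].
Qed.
(* No [algType] instance here: in the library algebras are nontrivial rings,
   and a presented algebra may be zero. *)

Definition pgen (x : X) : presented := cls (Gen x).

Lemma cls_Scal k : cls (Scal k) = k *: (1 : presented).
Proof.
rewrite [RHS]cls_scal; apply: cls_eq.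
by apply: teq_trans (teq_sym (teq_mul1 _)) (teq_sym (teq_scalC _ _)).
Qed.

Lemma cls_eval p : cls p = eval (fun k => k *: (1 : presented)) pgen p.
Proof.
elim: p => //= [k | p <- q <- | p <- q <-].
- exact: cls_Scal.
- by rewrite [RHS]cls_add.
- by rewrite [RHS]cls_mul.
Qed.

(* The map that extends sigma on scalars and g on generators; it is a ring
   morphism under the conditions [compatible] below. *)
Definition lift (A : pzRingType) (sigma : K -> A) (g : X -> A)
  (x : presented) : A := eval sigma g (repr x).

Definition compatible (A : pzRingType) (sigma : K -> A) (g : X -> A) : Prop :=
  (forall k a, GRing.comm (sigma k) a) /\
  (forall p q, prel p q -> eval sigma g p = eval sigma g q).

Section Lift.
Variables (A : pzRingType) (sigma : {rmorphism K -> A}) (g : X -> A).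
Hypothesis cg : compatible sigma g.

Lemma eval_teq p q : teq p q -> eval sigma g p = eval sigma g q.
Proof.
have [sC sR] := cg.
elim=> //=.
- by move=> ? ? ? _ -> _ ->.
- by move=> ? ? ? ? _ -> _ ->.
- by move=> ? ? ? ? _ -> _ ->.
- by move=> *; rewrite addrA.
- by move=> *; rewrite addrC.
- by move=> *; rewrite rmorph0 add0r.
- by move=> *; rewrite rmorph0 mul0r.
- by move=> *; rewrite mulrA.
- by move=> *; rewrite rmorph1 mul1r.
- by move=> *; rewrite mulrDl.
- by move=> *; rewrite mulrDr.
- by move=> *; rewrite rmorphD.
- by move=> *; rewrite rmorphM.
- by move=> k p'; apply: sC.
Qed.

Lemma lift_cls p : lift sigma g (cls p) = eval sigma g p.
Proof. exact/eval_teq/repr_cls. Qed.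
Lemma lift_pgen x : lift sigma g (pgen x) = g x.
Proof. exact: lift_cls. Qed.
Lemma lift_scale k x : lift sigma g (k *: x) = sigma k * lift sigma g x.
Proof. by elim/clsW: x => p; rewrite [k *: _]cls_scal !lift_cls. Qed.

Lemma lift_zmod : zmod_morphism (lift sigma g).
Proof.
have lD x y : lift sigma g (x + y) = lift sigma g x + lift sigma g y.
  elim/clsW: x => p; elim/clsW: y => q.
  by rewrite [cls p + _]cls_add !lift_cls.
move=> x y; rewrite lD; congr (_ + _).
by rewrite -scaleN1r lift_scale rmorphN1 mulN1r.
Qed.
Lemma lift_monoid : monoid_morphism (lift sigma g).
Proof.
split=> [|x y]; first by rewrite lift_cls /= rmorph1.
elim/clsW: x => p; elim/clsW: y => q.
by rewrite [cls p * _]cls_mul !lift_cls.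
Qed.
End Lift.

End Presented.

Section Tensor.
Variables (K : comNzRingType) (A B : algType K).

(* A ⊗ B is generated by the elements a ⊗ 1 and 1 ⊗ b; the relations say
   that a |-> a ⊗ 1 and b |-> 1 ⊗ b are morphisms of K-algebras whose images
   commute, which is the universal property of the tensor product. *)
Inductive tensor_rel : term K (A + B) -> term K (A + B) -> Prop :=
  | tensor_addl a a' :
      tensor_rel (Gen (inl (a + a'))) (Add (Gen (inl a)) (Gen (inl a')))
  | tensor_mull a a' :
      tensor_rel (Gen (inl (a * a'))) (Mul (Gen (inl a)) (Gen (inl a')))
  | tensor_scall k : tensor_rel (Gen (inl k%:A)) (Scal k)
  | tensor_addr b b' :
      tensor_rel (Gen (inr (b + b'))) (Add (Gen (inr b)) (Gen (inr b')))
  | tensor_mulr b b' :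
      tensor_rel (Gen (inr (b * b'))) (Mul (Gen (inr b)) (Gen (inr b')))
  | tensor_scalr k : tensor_rel (Gen (inr k%:A)) (Scal k)
  | tensor_comm a b :
      tensor_rel (Mul (Gen (inl a)) (Gen (inr b)))
                 (Mul (Gen (inr b)) (Gen (inl a))).

Definition tensor := presented tensor_rel.
HB.instance Definition _ := GRing.PzRing.on tensor.
HB.instance Definition _ := GRing.Lmodule.on tensor.

Let inL (a : A) : tensor := pgen tensor_rel (inl a).
Let inR (b : B) : tensor := pgen tensor_rel (inr b).

Definition tens (a : A) (b : B) : tensor := inL a * inR b.

Lemma tens1l b : tens 1 b = inR b.
Proof.
suff -> : tens 1 b = 1 * inR b by rewrite mul1r.
congr (_ * _); rewrite -(scale1r (1 : A)) -(scale1r (1 : tensor)) -cls_Scal.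
exact/cls_eq/teq_rel/tensor_scall.
Qed.
Lemma tens1r a : tens a 1 = inL a.
Proof.
suff -> : tens a 1 = inL a * 1 by rewrite mulr1.
congr (_ * _); rewrite -(scale1r (1 : B)) -(scale1r (1 : tensor)) -cls_Scal.
exact/cls_eq/teq_rel/tensor_scalr.
Qed.
Lemma tens11 : tens 1 1 = 1.
Proof.
rewrite tens1l -(scale1r (1 : B)) -(scale1r (1 : tensor)) -cls_Scal.
exact/cls_eq/teq_rel/tensor_scalr.
Qed.
Lemma tensE a b : tens a b = tens a 1 * tens 1 b.
Proof. by rewrite tens1l tens1r. Qed.
Lemma tensC a b : tens 1 b * tens a 1 = tens a 1 * tens 1 b.
Proof.
rewrite tens1l tens1r [LHS]cls_mul [RHS]cls_mul.
exact/cls_eq/teq_sym/teq_rel/tensor_comm.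
Qed.
Lemma tensDl a a' : tens (a + a') 1 = tens a 1 + tens a' 1.
Proof.
by rewrite !tens1r [RHS]cls_add; apply/cls_eq/teq_rel/tensor_addl.
Qed.
Lemma tensDr b b' : tens 1 (b + b') = tens 1 b + tens 1 b'.
Proof.
by rewrite !tens1l [RHS]cls_add; apply/cls_eq/teq_rel/tensor_addr.
Qed.
Lemma tensMl a a' : tens (a * a') 1 = tens a 1 * tens a' 1.
Proof.
by rewrite !tens1r [RHS]cls_mul; apply/cls_eq/teq_rel/tensor_mull.
Qed.
Lemma tensMr b b' : tens 1 (b * b') = tens 1 b * tens 1 b'.
Proof.
by rewrite !tens1l [RHS]cls_mul; apply/cls_eq/teq_rel/tensor_mulr.
Qed.
Lemma tensZl k a : tens (k *: a) 1 = k *: tens a 1.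
Proof.
rewrite -[a in LHS]mul1r scalerAl tensMl.
have -> : tens k%:A 1 = k *: (1 : tensor).
  by rewrite tens1r -cls_Scal; apply/cls_eq/teq_rel/tensor_scall.
by rewrite -pscalAl mul1r.
Qed.
Lemma tensZr k b : tens 1 (k *: b) = k *: tens 1 b.
Proof.
rewrite -[b in LHS]mul1r scalerAl tensMr.
have -> : tens 1 k%:A = k *: (1 : tensor).
  by rewrite tens1l -cls_Scal; apply/cls_eq/teq_rel/tensor_scalr.
by rewrite -pscalAl mul1r.
Qed.
End Tensor.

Notation "a ⊗ b" := (tens a b)
  (at level 40, b at next level, left associativity) : ring_scope.

(* Signs: [true] stands for + and [false] for -. *)
Definition sg (F : pzRingType) (b : bool) : F := if b then 1 else -1.

Inductive ygen := GE of bool | GH | GEh of bool | GHh.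

Section YangianDef.
Variable F : numFieldType.

(* The Yangian is an algebra over F[alpha], alpha the deformation parameter. *)
Local Notation K := {poly F}.
Notation alpha := ('X : K).

Local Notation E b := (@Gen K ygen (GE b)).
Local Notation H := (@Gen K ygen GH).
Local Notation Eh b := (@Gen K ygen (GEh b)).
Local Notation Hh := (@Gen K ygen GHh).
Local Notation "p +' q" := (Add p q) (at level 50, left associativity).
Local Notation "p *' q" := (Mul p q) (at level 40, left associativity).
Local Notation "k *:' p" := (Mul (Scal k) p) (at level 40).
Local Notation "p -' q" := (Add p ((-1) *:' q)) (at level 50).
Local Notation "[[ p , q ]]" := (p *' q -' q *' p).

(* The last relation is Drinfeld's Serre-type relation: for sl(2) his relations
   form one irreducible (spin 2) sl(2)-module, generated by its element of
   weight 0 below. The right-hand side is the one for which the coproduct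
   [Delta] is well defined. *)
Inductive yrel : term K ygen -> term K ygen -> Prop :=
  | yrel_HE b : yrel [[H, E b]] ((sg K b * 2) *:' E b)
  | yrel_EE : yrel [[E true, E false]] H
  | yrel_HEh b : yrel [[H, Eh b]] ((sg K b * 2) *:' Eh b)
  | yrel_HhE b : yrel [[Hh, E b]] ((sg K b * 2) *:' Eh b)
  | yrel_EEh b : yrel [[E b, Eh (~~ b)]] (sg K b *:' Hh)
  | yrel_HHh : yrel [[H, Hh]] (Scal 0)
  | yrel_EEh0 b : yrel [[E b, Eh b]] (Scal 0)
  | yrel_serre : yrel [[Hh, [[Eh true, Eh false]]]]
      (alpha ^+ 2 *:'
        ((Eh false *' E true -' E false *' Eh true) *' H)).

Definition yangian := presented yrel.
HB.instance Definition _ := GRing.PzRing.on yangian.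
HB.instance Definition _ := GRing.Lmodule.on yangian.

(* The counit shows that the Yangian is a nontrivial ring. *)
Definition counit : yangian -> K := lift idfun (fun=> 0).

Fact yangian_neq0 : 1 != 0 :> yangian.
Proof.
have cg : compatible yrel (idfun : K -> K) (fun=> 0).
  split=> [k a|p q]; first exact: mulrC.
  by case=> *; rewrite /= ?(mul0r, mulr0, addr0).
have cD : zmod_morphism counit := lift_zmod cg.
have [c1 _] : monoid_morphism counit := lift_monoid cg.
have c0 : counit 0 = 0 by rewrite -[0 in LHS](subrr 0) cD subrr.
by apply/eqP => /(congr1 counit); rewrite c1 c0; apply/eqP/oner_neq0.
Qed.
HB.instance Definition _ :=
  GRing.PzSemiRing_isNonZero.Build yangian yangian_neq0.
HB.instance Definition _ :=
  GRing.LSemiModule_isLSemiAlgebra.Build K yangian (@pscalAl _ _ yrel).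
HB.instance Definition _ :=
  GRing.LSemiAlgebra_isSemiAlgebra.Build K yangian (@pscalAr _ _ yrel).

Definition yE b : yangian := pgen yrel (GE b).
Definition yH : yangian := pgen yrel GH.
Definition yEh b : yangian := pgen yrel (GEh b).
Definition yHh : yangian := pgen yrel GHh.

Definition comm_of (x y : yangian) : yangian := x * y - y * x.

Definition yy := tensor yangian yangian.
HB.instance Definition _ := GRing.PzRing.on yy.
HB.instance Definition _ := GRing.Lmodule.on yy.

Definition Delta_gen (x : ygen) : yy :=
  match x with
  | GE b => yE b ⊗ 1 + 1 ⊗ yE b
  | GH => yH ⊗ 1 + 1 ⊗ yH
  | GHh => yHh ⊗ 1 + 1 ⊗ yHh
           - alpha *: (yE true ⊗ yE false - yE false ⊗ yE true)
  | GEh b => yEh b ⊗ 1 + 1 ⊗ yEh b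
             + ((sg F b / 2)%:P * alpha) *: (yE b ⊗ yH - yH ⊗ yE b)
  end.

Definition yy_scal (k : K) : yy := k *: (1 : yy).

(* The coproduct; [Delta_compatible] below shows that it is well defined, and
   thus a morphism of rings. *)
Definition Delta : yangian -> yy := lift yy_scal Delta_gen.

End YangianDef.

Section NormalForm.

Definition ycode (x : ygen) : nat :=
  match x with
  | GE false => 0 | GH => 1 | GE true => 2
  | GEh false => 3 | GHh => 4 | GEh true => 5
  end.
Definition ydecode (n : nat) : ygen :=
  match n with
  | 0 => GE false | 1 => GH | 2 => GE true
  | 3 => GEh false | 4 => GHh | _ => GEh true
  end.
Fact ycodeK : cancel ycode ydecode. Proof. by do ![case]. Qed.
HB.instance Definition _ := Countable.copy ygen (can_type ycodeK).

(* A monomial (z, d, w) stands for z beta^d w, with beta = alpha / 2; the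
   letters of the word w are the generators of the two tensor factors. *)
Local Notation letter := (bool * ygen)%type.
Local Notation mono := (int * nat * seq letter)%type.

(* [ycomm x y] is [[x, y]] when x should be moved to the right of y. *)
Definition ycomm (x y : ygen) : option (seq (int * ygen)) :=
  match x, y with
  | GH, GE false => Some [:: (-2%:Z, GE false)]
  | GE true, GE false => Some [:: (1%:Z, GH)]
  | GE true, GH => Some [:: (-2%:Z, GE true)]
  | GEh false, GE false => Some [::]
  | GEh false, GH => Some [:: (2%:Z, GEh false)]
  | GEh false, GE true => Some [:: (-1%:Z, GHh)]
  | GHh, GE false => Some [:: (-2%:Z, GEh false)]
  | GHh, GH => Some [::]
  | GHh, GE true => Some [:: (2%:Z, GEh true)]
  | GEh true, GE false => Some [:: (1%:Z, GHh)]
  | GEh true, GH => Some [:: (-2%:Z, GEh true)]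
  | GEh true, GE true => Some [::]
  | _, _ => None
  end.

Definition lcomm (x y : letter) : option (seq (int * letter)) :=
  if x.1 == y.1 then
    omap (map (fun m => (m.1, (x.1, m.2)))) (ycomm x.2 y.2)
  else if x.1 then Some [::] else None.

Definition mscale (z : int) (d : nat) (p : seq mono) : seq mono :=
  [seq (z * m.1.1, (d + m.1.2)%N, m.2) | m <- p].

Fixpoint ins (n : nat) (x : letter) (w : seq letter) : seq mono :=
  match n, w with
  | n'.+1, y :: w' =>
    if lcomm x y is Some l then
      flatten [seq mscale m.1.1 m.1.2 (ins n' y m.2) | m <- ins n' x w']
      ++ flatten [seq mscale m.1 0 (ins n' m.2 w') | m <- l]
    else [:: (1, 0%N, x :: w)]
  | _, _ => [:: (1, 0%N, x :: w)]
  end.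

Definition insp n x (p : seq mono) : seq mono :=
  flatten [seq mscale m.1.1 m.1.2 (ins n x m.2) | m <- p].

Definition mulp n (p q : seq mono) : seq mono :=
  flatten [seq mscale m.1.1 m.1.2 (foldr (insp n) q m.2) | m <- p].

Local Notation iterm := (term (int * nat) letter).

Fixpoint nf n (p : iterm) : seq mono :=
  match p with
  | Gen x => [:: (1, 0%N, [:: x])]
  | Scal (z, d) => [:: (z, d, [::])]
  | Add p q => nf n p ++ nf n q
  | Mul p q => mulp n (nf n p) (nf n q)
  end.

Fixpoint addm (m : mono) (p : seq mono) : seq mono :=
  if p is m' :: p' then
    if (m.1.2 == m'.1.2) && (m.2 == m'.2)
    then (m.1.1 + m'.1.1, m.1.2, m.2) :: p' else m' :: addm m p'
  else [:: m].

Definition iszero n (p : iterm) : bool :=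
  all (fun m => m.1.1 == 0) (foldr addm [::] (nf n p)).

Variables (K : comNzRingType) (X : Type) (prel : term K X -> term K X -> Prop).
Local Notation A := (presented prel).
Variables (beta : K) (x : letter -> A).
Hypothesis xC : forall a b l, lcomm a b = Some l ->
  x a * x b = x b * x a + \sum_(m <- l) m.1%:~R *: x m.2.

Let coef (c : int * nat) : K := c.1%:~R * beta ^+ c.2.
Let ev := eval (fun c => coef c *: (1 : A)) x.
Let evw (w : seq letter) : A := \prod_(a <- w) x a.
Let evp (p : seq mono) : A := \sum_(m <- p) coef m.1 *: evw m.2.

Lemma evp_cat p q : evp (p ++ q) = evp p + evp q.
Proof. exact: big_cat. Qed.

Lemma coefM z d z' d' : coef (z * z', (d + d')%N) = coef (z, d) * coef (z', d').
Proof. by rewrite /coef /= intrM exprD mulrACA. Qed.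

Lemma evp_scale z d p : evp (mscale z d p) = coef (z, d) *: evp p.
Proof.
rewrite /evp big_map scaler_sumr; apply: eq_bigr => -[[z' d'] w] _ /=.
by rewrite coefM scalerA.
Qed.

Lemma evp_flatten (T : Type) (f : T -> seq mono) (s : seq T) :
  evp (flatten [seq f t | t <- s]) = \sum_(t <- s) evp (f t).
Proof.
by elim: s => [|t s IH]; rewrite /= ?big_nil ?big_cons ?evp_cat ?IH // /evp big_nil.
Qed.

Lemma evp1 w : evp [:: (1, 0%N, w)] = evw w.
Proof. by rewrite /evp big_seq1 /coef /= mul1r expr0 scale1r. Qed.

Lemma evw_cons a w : evw (a :: w) = x a * evw w.
Proof. exact: big_cons. Qed.

Lemma evp_ins n a w : evp (ins n a w) = x a * evw w.
Proof.
elim: n a w => [|n IH] a [|b w] /=; rewrite ?evp1 ?evw_cons //.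
case ab: lcomm => [l|]; last by rewrite evp1 !evw_cons.
rewrite evp_cat !evp_flatten mulrA (xC ab) mulrDl; congr (_ + _).
  rewrite -mulrA -IH mulr_sumr; apply: eq_bigr => -[[z d] w'] _ /=.
  by rewrite evp_scale IH pscalAr.
rewrite mulr_suml; apply: eq_bigr => -[z c] _ /=.
by rewrite evp_scale IH /coef /= expr0 mulr1 pscalAl.
Qed.

Lemma evp_insp n a p : evp (insp n a p) = x a * evp p.
Proof.
rewrite evp_flatten mulr_sumr; apply: eq_bigr => -[[z d] w] _ /=.
by rewrite evp_scale evp_ins pscalAr.
Qed.

Lemma evp_mulp n p q : evp (mulp n p q) = evp p * evp q.
Proof.
rewrite evp_flatten mulr_suml; apply: eq_bigr => -[[z d] w] _ /=.
rewrite evp_scale -pscalAl; congr (_ *: _).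
elim: w => [|a w IH] /=; first by rewrite /evw big_nil mul1r.
by rewrite evp_insp IH evw_cons mulrA.
Qed.

Lemma evp_nf n p : evp (nf n p) = ev p.
Proof.
elim: p => [a|[z d]|p IHp q IHq|p IHp q IHq] /=.
- by rewrite evp1 /evw big_seq1.
- by rewrite /evp big_seq1 /evw big_nil.
- by rewrite evp_cat IHp IHq.
- by rewrite evp_mulp IHp IHq.
Qed.

Lemma evp_addm m p : evp (addm m p) = coef m.1 *: evw m.2 + evp p.
Proof.
elim: p => [|m' p IH] /=; first by rewrite /evp big_seq1 big_nil addr0.
case: ifP => [/andP[/eqP dE /eqP wE]|_]; rewrite /evp !big_cons /=.
  by rewrite addrA -wE -scalerDl /coef -dE /= intrD mulrDl.
by rewrite -/(evp _) IH addrCA.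
Qed.

Lemma iszero_ev n p : iszero n p -> ev p = 0.
Proof.
rewrite -(evp_nf n) /iszero => z0.
have -> : evp (nf n p) = evp (foldr addm [::] (nf n p)).
  elim: (nf n p) => //= m q IH.
  by rewrite evp_addm -IH /evp big_cons.
elim: (foldr _ _ _) z0 => [|[[z d] w] q IH] /=; first by rewrite /evp big_nil.
case/andP=> /eqP -> /IH q0; rewrite /evp big_cons -/(evp _) q0.
by rewrite /coef /= mul0r scale0r addr0.
Qed.

End NormalForm.

Fixpoint tsubst (K X Y : Type) (f : X -> term K Y) (p : term K X) : term K Y :=
  match p with
  | Gen x => f x
  | Scal k => Scal k
  | Add p q => Add (tsubst f p) (tsubst f q)
  | Mul p q => Mul (tsubst f p) (tsubst f q)
  end.
Fixpoint tmap (K L X : Type) (f : K -> L) (p : term K X) : term L X :=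
  match p with
  | Gen x => Gen x
  | Scal k => Scal (f k)
  | Add p q => Add (tmap f p) (tmap f q)
  | Mul p q => Mul (tmap f p) (tmap f q)
  end.
Lemma eval_tsubst (K X Y : Type) (A : pzRingType) (sigma : K -> A) (g : Y -> A)
    (f : X -> term K Y) p :
  eval sigma g (tsubst f p) = eval sigma (fun x => eval sigma g (f x)) p.
Proof. by elim: p => //= [p -> q -> | p -> q ->]. Qed.
Lemma eval_tmap (K L X : Type) (A : pzRingType) (sigma : L -> A) (g : X -> A)
    (f : K -> L) p :
  eval sigma g (tmap f p) = eval (fun k => sigma (f k)) g p.
Proof. by elim: p => //= [p -> q -> | p -> q ->]. Qed.
Lemma eq_eval (K X : Type) (A : pzRingType) (sigma sigma' : K -> A)
    (g g' : X -> A) : sigma =1 sigma' -> g =1 g' ->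
  eval sigma g =1 eval sigma' g'.
Proof. by move=> es eg; elim=> //= [p -> q -> | p -> q ->]. Qed.

Section DeltaMorphism.
Variable F : numFieldType.
Local Notation K := {poly F}.
Local Notation Y := (yangian F).
Local Notation YY := (yy F).

Let sgz (b : bool) : int := if b then 1 else -1.
Let beta : K := (2^-1)%:P * 'X.
Let coef (c : int * nat) : K := c.1%:~R * beta ^+ c.2.
Let letters (c : bool * ygen) : YY :=
  let y : Y := pgen (@yrel F) c.2 in if c.1 then 1 ⊗ y else y ⊗ 1.

Local Notation iterm X := (term (int * nat) X).
Let D (x : ygen) : iterm (bool * ygen) :=
  let l c := Gen (false, c) in
  let r c := Gen (true, c) in
  let anti a b := Add (Mul (l a) (r b)) (Mul (Scal (-1, 0%N)) (Mul (l b) (r a))) in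
  let prim := Add (l x) (r x) in
  match x with
  | GE _ | GH => prim
  | GHh => Add prim (Mul (Scal (-2%:Z, 1%N)) (anti (GE true) (GE false)))
  | GEh b => Add prim (Mul (Scal (sgz b, 1%N)) (anti (GE b) GH))
  end.

Let alphaE : 'X = 2%:R * beta.
Proof.
by rewrite /beta mulrA -polyC_natr -polyCM mulfV ?mul1r // pnatr_eq0.
Qed.

Let scaleM k (y : YY) : (k *: (1 : YY)) * y = k *: y.
Proof. by rewrite -pscalAl mul1r. Qed.

Let ev_D x :
  eval (fun c => coef c *: (1 : YY)) letters (D x) = Delta_gen F x.
Proof.
have e (a b : Y) : a ⊗ 1 * (1 ⊗ b) = a ⊗ b by rewrite [RHS]tensE.
have m1 : coef (-1, 0%N) = -1 by rewrite /coef /= expr0 mulr1.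
case: x => [b||b|] //=; rewrite /letters /= !scaleM !e m1 scaleN1r; congr (_ + _).
  congr (_ *: _); rewrite /coef /= expr1 /beta polyCM -mulrA; congr (_ * _).
  by case: b => //=; rewrite polyCN.
by rewrite -scaleNr; congr (_ *: _); rewrite alphaE /coef /= expr1 mulNr.
Qed.

Let brk X (p q : iterm X) := Add (Mul p q) (Mul (Scal (-1, 0%N)) (Mul q p)).
Let iE b : iterm ygen := Gen (GE b).
Let iH : iterm ygen := Gen GH.
Let iEh b : iterm ygen := Gen (GEh b).
Let iHh : iterm ygen := Gen GHh.
Let sc X z d (p : iterm X) := Mul (Scal (z, d)) p.

Let irels : seq (iterm ygen * iterm ygen) :=
  flatten [seq [:: (brk iH (iE b), sc (sgz b * 2) 0%N (iE b));
     (brk iH (iEh b), sc (sgz b * 2) 0%N (iEh b));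
     (brk iHh (iE b), sc (sgz b * 2) 0%N (iEh b));
     (brk (iE b) (iEh (~~ b)), sc (sgz b) 0%N iHh);
     (brk (iE b) (iEh b), Scal (0, 0%N))] | b <- [:: true; false]]
  ++ [:: (brk (iE true) (iE false), iH);
     (brk iH iHh, Scal (0, 0%N));
     (brk iHh (brk (iEh true) (iEh false)),
      sc 4 2%N (Mul (Add (Mul (iEh false) (iE true))
         (Mul (Scal (-1, 0%N)) (Mul (iE false) (iEh true)))) iH))].

Let yrel_irels p q : yrel p q ->
  exists2 i, (i < size irels)%N &
    let r := nth (Scal (0, 0%N), Scal (0, 0%N)) irels i in
    p = tmap coef r.1 /\ q = tmap coef r.2.
Proof.
have m1 : coef (-1, 0%N) = -1 by rewrite /coef /= expr0 mulr1.
have m0 : coef (0, 0%N) = 0 by rewrite /coef /= mul0r.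
have ms b : coef (sgz b, 0%N) = sg K b.
  by rewrite /coef /= expr0 mulr1; case: b.
have ms2 b : coef (sgz b * 2, 0%N) = sg K b * 2.
  by rewrite /coef /= expr0 mulr1 intrM; case: b.
have m4 : coef (4, 2%N) = 'X ^+ 2.
  by rewrite alphaE exprMn /coef /= -natrX.
have /= t1 := ms true; have /= f1 := ms false.
have /= t2 := ms2 true; have /= f2 := ms2 false.
case=> [b||b|b|b||b|].
- by exists (if b then 0 else 5)%N; case: b => //=; rewrite m1 ?t2 ?f2.
- by exists 10%N => //=; rewrite m1.
- by exists (if b then 1 else 6)%N; case: b => //=; rewrite m1 ?t2 ?f2.
- by exists (if b then 2 else 7)%N; case: b => //=; rewrite m1 ?t2 ?f2.
- by exists (if b then 3 else 8)%N; case: b => //=; rewrite ?t1 m1 ?f1.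
- by exists 11%N => //=; rewrite m1 m0.
- by exists (if b then 4 else 9)%N; case: b => //=; rewrite m1 m0.
- by exists 12%N => //=; rewrite m1 m4.
Qed.

Let ev_letters f p : eval (fun k : K => k *: (1 : YY)) (fun x => letters (f, x)) p
  = let y : Y := cls (@yrel F) p in if f then 1 ⊗ y else y ⊗ 1.
Proof.
elim: p => [x|k|p IHp q IHq|p IHp q IHq] /=.
- by [].
- by rewrite cls_Scal; case: (f); rewrite ?tensZl ?tensZr tens11.
- rewrite IHp IHq -cls_add; case: (f); first exact/esym/tensDr.
  exact/esym/tensDl.
- rewrite IHp IHq -cls_mul; case: (f); first exact/esym/tensMr.
  exact/esym/tensMl.
Qed.

Let ev_letters_rel f p q : yrel p q ->
  eval (fun k : K => k *: (1 : YY)) (fun x => letters (f, x)) p =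
  eval (fun k : K => k *: (1 : YY)) (fun x => letters (f, x)) q.
Proof. by move=> pq; rewrite !ev_letters; have /= -> := cls_eq (teq_rel pq). Qed.

Let relC (f : bool) (x y : ygen) p q : yrel p q ->
  p = Add (Mul (Gen x) (Gen y)) (Mul (Scal (-1)) (Mul (Gen y) (Gen x))) ->
  letters (f, x) * letters (f, y) = letters (f, y) * letters (f, x) +
    eval (fun k : K => k *: (1 : YY)) (fun x => letters (f, x)) q.
Proof.
move=> pq pE; rewrite -(ev_letters_rel f pq) pE /= scaleM scaleN1r.
by rewrite addrCA subrr addr0.
Qed.

Let lettersC a b l : lcomm a b = Some l ->
  letters a * letters b = letters b * letters a +
    \sum_(m <- l) m.1%:~R *: letters m.2.
Proof.
have op (u v w : YY) : u * v = v * u + w -> v * u = u * v - w.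
  by move->; rewrite addrK.
case: a b => f x [f' y]; rewrite /lcomm /=; case: eqVneq => [<-|ff']; last first.
  case: f f' ff' => -[] // _ [<-]; rewrite big_nil addr0.
  exact: tensC.
have HE b := relC f (yrel_HE F b) erefl.
have EE := relC f (yrel_EE F) erefl.
have HEh b := relC f (yrel_HEh F b) erefl.
have HhE b := relC f (yrel_HhE F b) erefl.
have EEh b := relC f (yrel_EEh F b) erefl.
have HHh := relC f (yrel_HHh F) erefl.
have EEh0 b := relC f (yrel_EEh0 F b) erefl.
have s2 b : sg K b * 2 = (sgz b * 2)%:~R by rewrite intrM; case: b.
have s1 b : sg K b = (sgz b)%:~R by case: b.
have zN (z : int) (u : YY) : - (z%:~R *: u) = (- z)%:~R *: u.
  by rewrite intrN scaleNr.
have to k z (u v w : YY) : k = z%:~R -> u * v = v * u + (k *: (1 : YY)) * w ->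
    (u * v = v * u + z%:~R *: w) * (v * u = u * v + (- z)%:~R *: w).
  by move=> ->; rewrite scaleM => uv; rewrite -zN uv addrK.
have to0 (u v : YY) : u * v = v * u + 0 *: (1 : YY) ->
    (u * v = v * u) * (v * u = u * v).
  by rewrite scale0r addr0 => ->.
move: HE EE HEh HhE EEh HHh EEh0; rewrite /=.
move=> HE EE HEh HhE EEh HHh EEh0.
have {}HE b := to _ _ _ _ _ (s2 b) (HE b).
have {}HEh b := to _ _ _ _ _ (s2 b) (HEh b).
have {}HhE b := to _ _ _ _ _ (s2 b) (HhE b).
have {}EEh b := to _ _ _ _ _ (s1 b) (EEh b).
have {}HHh := to0 _ _ HHh.
have {}EEh0 b := to0 _ _ (EEh0 b).
case: x y => [[]||[]|] [[]||[]|] //= [<-]; rewrite ?big_seq1 ?big_nil ?addr0 /=.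
- rewrite EE; congr (_ + _); exact: esym (scale1r _).
- exact: (HE true).2.
- exact: (HE false).1.
- exact: (EEh0 true).2.
- exact: (EEh false).2.
- exact: (HEh true).2.
- exact: (EEh true).2.
- exact: (EEh0 false).2.
- exact: (HEh false).2.
- exact: (HhE true).1.
- exact: (HhE false).1.
- exact: HHh.2.
Qed.

Let embed (f : bool) (p : iterm ygen) : iterm (bool * ygen) := tsubst (fun x => Gen (f, x)) p.

Lemma Delta_compatible :
  compatible (@yrel F) (fun k : K => k *: (1 : YY)) (Delta_gen F).
Proof.
split=> [k a|p q pq]; first by rewrite /GRing.comm scaleM -pscalAr mulr1.
have [i isz /= [pE qE]] := yrel_irels pq.
have in_factor f : eval (fun c => coef c *: (1 : YY)) letters
    (Add (embed f (nth (Scal (0, 0%N), Scal (0, 0%N)) irels i).1)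
      (Mul (Scal (-1, 0%N))
        (embed f (nth (Scal (0, 0%N), Scal (0, 0%N)) irels i).2))) = 0.
  rewrite /= !eval_tsubst /= scaleM.
  have := ev_letters_rel f pq; rewrite pE qE !eval_tmap => ->.
  by rewrite /coef /= expr0 mulr1 scaleN1r subrr.
have all0 : all (fun r =>
  iszero 1000 (Add (Add (tsubst D r.1) (Mul (Scal (-1, 0%N)) (tsubst D r.2)))
    (Mul (Scal (-1, 0%N)) (Add
      (Add (embed false r.1) (Mul (Scal (-1, 0%N)) (embed false r.2)))
      (Add (embed true r.1) (Mul (Scal (-1, 0%N)) (embed true r.2)))))))
  irels by vm_compute.
have := all_nthP (Scal (0, 0%N), Scal (0, 0%N)) all0 i isz.
move: (in_factor false) (in_factor true) pE qE.
set r := nth _ _ _ => r0 r1 pE qE /(iszero_ev beta lettersC) E.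
have {}E : eval (fun c => coef c *: (1 : YY)) letters (tsubst D r.1) +
    (coef (-1, 0%N) *: (1 : YY)) *
      eval (fun c => coef c *: (1 : YY)) letters (tsubst D r.2) +
    (coef (-1, 0%N) *: (1 : YY)) * (0 + 0) = 0.
  by rewrite -[X in _ * (X + _)]r0 -[X in _ * (_ + X)]r1.
move: E; rewrite addr0 mulr0 addr0 !eval_tsubst scaleM.
have -> : coef (-1, 0%N) = -1 by rewrite /coef /= expr0 mulr1.
rewrite scaleN1r => /eqP; rewrite subr_eq0 => /eqP E.
by rewrite pE qE !eval_tmap -!(eq_eval (frefl _) ev_D).
Qed.

Fact yy_scal_zmod : zmod_morphism (@yy_scal F).
Proof. by move=> k l; rewrite /yy_scal scalerBl. Qed.
Fact yy_scal_monoid : monoid_morphism (@yy_scal F).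
Proof.
split=> [|k l]; first exact: scale1r.
by rewrite /yy_scal scaleM scalerA.
Qed.
HB.instance Definition _ :=
  GRing.isZmodMorphism.Build K YY (@yy_scal F) yy_scal_zmod.
HB.instance Definition _ :=
  GRing.isMonoidMorphism.Build K YY (@yy_scal F) yy_scal_monoid.
HB.instance Definition _ := GRing.isZmodMorphism.Build Y YY (@Delta F)
  (lift_zmod (sigma := @yy_scal F) Delta_compatible).
HB.instance Definition _ := GRing.isMonoidMorphism.Build Y YY (@Delta F)
  (lift_monoid (sigma := @yy_scal F) Delta_compatible).

End DeltaMorphism.

Local Notation tofrac := (@FracField.tofrac _).
Local Notation "p %:F" := (tofrac p).

Section Evaluation.
Variables (F : numFieldType) (L : fieldType) (iota : {rmorphism F -> L}).
Local Notation K := {poly F}.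

(* Scalars of F[alpha] act with alpha specialized to 1. *)
Definition spec1 n (p : K) : 'M[L]_n := (iota p.[1])%:M.

Fact spec1_zmod n : zmod_morphism (@spec1 n).
Proof. by move=> p q; rewrite /spec1 hornerD hornerN !rmorphB. Qed.
Fact spec1_monoid n : monoid_morphism (@spec1 n).
Proof.
split=> [|p q]; first by rewrite /spec1 hornerC rmorph1.
by rewrite /spec1 hornerM rmorphM scalar_mxM.
Qed.
HB.instance Definition _ n :=
  GRing.isZmodMorphism.Build K 'M[L]_n (@spec1 n) (@spec1_zmod n).
HB.instance Definition _ n :=
  GRing.isMonoidMorphism.Build K 'M[L]_n (@spec1 n) (@spec1_monoid n).

Definition repE (b : bool) : 'M[L]_2 :=
  if b then delta_mx 0 1 else delta_mx 1 0.
Definition repH : 'M[L]_2 := delta_mx 0 0 - delta_mx 1 1.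

Definition eval_rep_gen (z : L) (x : ygen) : 'M[L]_2 :=
  match x with
  | GE b => repE b
  | GH => repH
  | GEh b => z *: repE b
  | GHh => z *: repH
  end.

Definition eval_rep (z : L) : yangian F -> 'M[L]_2 :=
  lift (@spec1 2) (eval_rep_gen z).

Lemma eval_rep_compatible z : compatible (@yrel F) (@spec1 2) (eval_rep_gen z).
Proof.
have sc p (a : 'M[L]_2) : spec1 2 p * a = iota p.[1] *: a.
  exact: mul_scalar_mx.
split=> [p a|p q].
  by rewrite /GRing.comm sc; apply: esym; apply: mul_mx_scalar.
pose e i j : 'M[L]_2 := delta_mx i j.
have ee i j k l : e i j * e k l = e i l *+ (j == k) by exact: mul_delta_mx_cond.
have HE b : repH * repE b = iota (sg F b) *: repE b.
  rewrite /repH -/(e _ _) -/(e _ _); case: b; rewrite /repE -/(e _ _).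
    by rewrite mulrBl !ee /= mulr1n mulr0n subr0 rmorph1 scale1r.
  by rewrite mulrBl !ee /= mulr1n mulr0n sub0r rmorphN1 scaleN1r.
have EH b : repE b * repH = - (iota (sg F b) *: repE b).
  rewrite /repH -/(e _ _) -/(e _ _); case: b; rewrite /repE -/(e _ _).
    by rewrite mulrBr !ee /= mulr1n mulr0n sub0r rmorph1 scale1r.
  by rewrite mulrBr !ee /= mulr1n mulr0n subr0 rmorphN1 scaleN1r opprK.
have EE0 b : repE b * repE b = 0.
  by case: b; rewrite /repE -/(e _ _) ee.
have EE : repE true * repE false - repE false * repE true = repH.
  by rewrite /repE -/(e _ _) -/(e _ _) !ee.
have EEb b : repE b * repE (~~ b) - repE (~~ b) * repE b =
    iota (sg F b) *: repH.
  case: b; first by rewrite EE rmorph1 scale1r.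
  by rewrite rmorphN1 scaleN1r -EE opprB.
have s2 b : iota (sg K b * 2).[1] = iota (sg F b) + iota (sg F b).
  rewrite hornerM -polyC_natr hornerC rmorphM rmorph_nat mulr_natr mulr2n.
  by case: b => /=; rewrite ?hornerN hornerC.
have s1 b : iota (sg K b).[1] = iota (sg F b).
  by case: b => /=; rewrite ?hornerN hornerC.
have HEB b : repH * repE b - repE b * repH = iota (sg K b * 2).[1] *: repE b.
  by rewrite HE EH opprK -scalerDl s2.
case=> [b||b|b|b||b|] /=; rewrite ?rmorphN1 ?mulN1r ?sc ?rmorph0;
  rewrite -?(scalerAl, scalerAr).
- exact: HEB.
- exact: EE.
- by rewrite -scalerBr HEB !scalerA mulrC.
- by rewrite -scalerBr HEB !scalerA mulrC.
- by rewrite -scalerBr EEb !scalerA s1 mulrC.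
- exact: subrr.
- by rewrite EE0 scaler0 subrr.
- by rewrite -!scalerBr EE -!(scalerAl, scalerAr) !subrr mul0r !scaler0.
Qed.
HB.instance Definition _ z := GRing.isZmodMorphism.Build (yangian F) 'M[L]_2
  (eval_rep z) (lift_zmod (eval_rep_compatible z)).
HB.instance Definition _ z := GRing.isMonoidMorphism.Build (yangian F) 'M[L]_2
  (eval_rep z) (lift_monoid (eval_rep_compatible z)).

(* The representation S ⊗ T of Y ⊗ Y on L^2 ⊗ L^2, in the basis
   v1 ⊗ v1, v1 ⊗ v2, v2 ⊗ v1, v2 ⊗ v2, for S = T_z and T = T_w. *)
Definition tens_rep (z w : L) : yy F -> 'M[L]_(2 * 2) :=
  lift (@spec1 (2 * 2)) (fun x : yangian F + yangian F =>
    match x with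
    | inl a => eval_rep z a *t 1%:M
    | inr b => 1%:M *t eval_rep w b
    end).

Lemma tens_rep_compatible z w :
  compatible (@tensor_rel K (yangian F) (yangian F)) (@spec1 (2 * 2))
    (fun x : yangian F + yangian F =>
      match x with
      | inl a => eval_rep z a *t 1%:M
      | inr b => 1%:M *t eval_rep w b
      end).
Proof.
split=> [p a|p q]; first exact/esym/(scalar_mxC _ a).
have eZ z' k : eval_rep z' (k *: (1 : yangian F)) = (iota k.[1])%:M.
  have -> : eval_rep z' (k *: (1 : yangian F)) = spec1 2 k * eval_rep z' 1.
    exact: (lift_scale (eval_rep_compatible z')).
  by rewrite rmorph1 mulr1.
have mulE n (a b : 'M[L]_n) : a * b = a *m b by [].
case=> [a a'|a a'|k|b b'|b b'|k|a b] /=.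
- by rewrite rmorphD; apply/matrixP => i j; rewrite !mxE mulrDl.
- by rewrite rmorphM !mulE tensmx_mul mulmx1.
- rewrite eZ; apply/matrixP => i j.
  case: (mxtens_indexP i) => i0 i1; case: (mxtens_indexP j) => j0 j1.
  rewrite tensmxE !mxE (can_eq (@mxtens_indexK _ _)) xpair_eqE.
  by rewrite mulr_natr -mulrnA mulnb.
- by rewrite rmorphD; apply/matrixP => i j; rewrite !mxE mulrDr.
- by rewrite rmorphM !mulE tensmx_mul mulmx1.
- rewrite eZ; apply/matrixP => i j.
  case: (mxtens_indexP i) => i0 i1; case: (mxtens_indexP j) => j0 j1.
  rewrite tensmxE !mxE (can_eq (@mxtens_indexK _ _)) xpair_eqE.
  by rewrite mulr_natl -mulrnA mulnb andbC.
- by rewrite !mulE !tensmx_mul !mul1mx !mulmx1.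
Qed.
HB.instance Definition _ z w := GRing.isZmodMorphism.Build (yy F) 'M[L]_(2 * 2)
  (tens_rep z w) (lift_zmod (tens_rep_compatible z w)).
HB.instance Definition _ z w :=
  GRing.isMonoidMorphism.Build (yy F) 'M[L]_(2 * 2)
  (tens_rep z w) (lift_monoid (tens_rep_compatible z w)).

Lemma tens_repE z w a b :
  tens_rep z w (a ⊗ b) = eval_rep z a *t eval_rep w b.
Proof.
have cg := tens_rep_compatible z w.
have [_ tM] := lift_monoid cg.
by rewrite [LHS]tM !(lift_pgen cg) [LHS]tensmx_mul mulmx1 mul1mx.
Qed.

(* The value at z of a rational function with coefficients in F; it is meant
   for z transcendental over F, see [ratfun_evalE]. *)
Definition ratfun_eval (z : L) (f : {fraction {poly F}}) : L :=
  (map_poly iota \n_(repr f)).[z] / (map_poly iota \d_(repr f)).[z].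

Lemma ratfun_evalE z (n d : {poly F}) :
  (forall p, p != 0 -> ~~ root (map_poly iota p) z) -> d != 0 ->
  ratfun_eval z (n%:F / d%:F) = (map_poly iota n).[z] / (map_poly iota d).[z].
Proof.
move=> tr d0; set f := _ / _.
have fd0 : \d_(repr f) != 0 by apply: denom_ratioP.
rewrite /ratfun_eval; apply/eqP; rewrite eqr_div; try exact: tr.
rewrite -!hornerM -!rmorphM; apply/eqP; congr (map_poly _ _).[_]; apply/eqP.
rewrite -tofrac_eq !tofracM -eqr_div ?tofrac_eq0 // -/f.
apply/eqP; rewrite -[RHS]reprK; move: fd0; case: (repr f) => -[a b] /= b0 _.
rewrite !piE; apply/eqmodP.
rewrite /= FracField.equivfE /FracField.mulf /FracField.invf.
by rewrite !numden_Ratio ?oner_neq0 ?mul1r ?mulr1 // mulrC.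
Qed.

End Evaluation.

Section Reflection.
Variable L : fieldType.

Definition Rmat (z : L) : 'M[L]_(2 * 2) :=
  let r := z / (z - 1) in
  \matrix_(i, j) nth 0 (nth [::]
    [:: [:: 1; 0;     0;     0];
        [:: 0; r;     1 - r; 0];
        [:: 0; 1 - r; r;     0];
        [:: 0; 0;     0;     1]] i) j.

(* Operators on (L^2 ⊗ L^2) ⊗ L^2; 2 * (2 * 2) is convertible to
   2 * 2 * 2, and both bracketings order the basis lexicographically. *)
Definition op12 (A : 'M[L]_(2 * 2)) : 'M[L]_(2 * 2 * 2) := A *t (1%:M : 'M_2).
Definition op23 (A : 'M[L]_(2 * 2)) : 'M[L]_(2 * 2 * 2) := (1%:M : 'M_2) *t A.
Definition op13 (A : 'M[L]_(2 * 2)) : 'M[L]_(2 * 2 * 2) :=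
  \matrix_(i, j)
    let: (i12, i3) := mxtens_unindex i in
    let: (i1, i2) := mxtens_unindex i12 in
    let: (j12, j3) := mxtens_unindex j in
    let: (j1, j2) := mxtens_unindex j12 in
    A (mxtens_index (i1, i3)) (mxtens_index (j1, j3)) *+ (i2 == j2).

Let idx (i j k : 'I_2) : 'I_(2 * 2 * 2) :=
  mxtens_index (mxtens_index (i, j), k).

Lemma op12E A i j k i' j' k' : op12 A (idx i j k) (idx i' j' k') =
  A (mxtens_index (i, j)) (mxtens_index (i', j')) *+ (k == k').
Proof. by rewrite [LHS]tensmxE mxE mulr_natr. Qed.
Lemma op13E A i j k i' j' k' : op13 A (idx i j k) (idx i' j' k') =
  A (mxtens_index (i, k)) (mxtens_index (i', k')) *+ (j == j').
Proof. by rewrite /op13 mxE !mxtens_indexK. Qed.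
Lemma op23E A i j k i' j' k' : op23 A (idx i j k) (idx i' j' k') =
  A (mxtens_index (j, k)) (mxtens_index (j', k')) *+ (i == i').
Proof.
have idxA a b c :
    idx a b c = mxtens_index (a, mxtens_index (b, c)) :> 'I_(2 * (2 * 2)).
  by apply: val_inj; rewrite /= mulnDl -mulnA addnA.
by rewrite !idxA [LHS]tensmxE mxE mulr_natl.
Qed.

End Reflection.

Notation ratfun F := {fraction {poly F}}.

Section ReflectionAlgebra.
Variable F : numFieldType.

(* F(u, v) is realized as F(u)(v), and the entries of K(u) and K(v) are the
   values of those of K at the elements u and v of this field. *)
Definition reflection_equation (K : 'M[ratfun F]_(2 * 2)) : Prop :=
  let L : fieldType := ratfun (ratfun F) in
  let iota : {rmorphism F -> L} := (tofrac \o polyC) \o (tofrac \o polyC) in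
  let u : L := ('X%:F)%:P%:F in
  let v : L := 'X%:F in
  let Ku := map_mx (ratfun_eval iota u) K in
  let Kv := map_mx (ratfun_eval iota v) K in
  op12 (Rmat (u - v)) *m op13 Ku *m op12 (Rmat (u + v)) *m op23 Kv =
  op23 Kv *m op12 (Rmat (u + v)) *m op13 Ku *m op12 (Rmat (u - v)).

Local Notation Y := (yangian F).
Local Notation alpha := ('X : {poly F}).

Definition yEtt (t : F) (b : bool) : Y :=
  (sg F b / 2)%:P *:
    (comm_of (yHh F) (yEh F b)
     + alpha *: ((sg F b * t)%:P *: yEh F b + yH F * yEh F b - yE F b * yHh F)).

Definition yHtt (t : F) : Y := comm_of (yEtt t true) (yE F false).

(* The subalgebra generated by the first four families. *)
Inductive twisted_yangian (t : F) : Y -> Prop :=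
  | ty_E b : twisted_yangian t (yE F b)
  | ty_H : twisted_yangian t (yH F)
  | ty_Ett b : twisted_yangian t (yEtt t b)
  | ty_Htt : twisted_yangian t (yHtt t)
  | ty_scal k : twisted_yangian t k%:A
  | ty_add x y : twisted_yangian t x -> twisted_yangian t y ->
      twisted_yangian t (x + y)
  | ty_mul x y : twisted_yangian t x -> twisted_yangian t y ->
      twisted_yangian t (x * y).

Definition intertwines (t s : F) (K : 'M[ratfun F]_(2 * 2)) : Prop :=
  let iota : {rmorphism F -> ratfun F} := tofrac \o polyC in
  let u : ratfun F := 'X%:F in
  forall b : Y, twisted_yangian t b ->
    tens_rep iota (- u) (iota s) (Delta b) *m K =
    K *m tens_rep iota u (iota s) (Delta b).

End ReflectionAlgebra.

(* Main.v *)
From HB Require Import structures.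
Require Import Defs.
From mathcomp Require Import all_boot all_order all_algebra.
From mathcomp Require Import reals complex.
From mathcomp Require Import mxtens ring.
Import GRing.Theory Num.Theory.
Local Open Scope ring_scope.

Set Implicit Arguments.
Unset Strict Implicit.
Unset Printing Implicit Defensive.

Local Notation tofrac := (@FracField.tofrac _).
Local Notation "p %:F" := (tofrac p).

(* Commuting with sl(2) forces K = a + b P, where P is the flip of the two
   factors. On one evaluation representation T_u the remaining generators act
   by u^2 E^+-, up to a multiple of (t + 2) u E^+-; at t = -2 this is even in
   u, and on the tensor product they impose only the linear condition
   2 u a + (u^2 - s^2 + 1) b = 0. Hence K is proportional to
   u^2 - s^2 + 1 - 2 u P. As R is also a combination of 1 and P, both sides of
   the reflection equation lie in the image of the group algebra of S_3; they
   are reversals of each other, so only the coefficients of the two 3-cycles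
   have to be compared. *)

(** * Permutations of tensor factors, acting on basis indices *)

Section Swaps.
Variable n : nat.
Definition swap (x : 'I_(n * n)) : 'I_(n * n) :=
  let: (i, j) := mxtens_unindex x in mxtens_index (j, i).
Definition triple (i j k : 'I_n) : 'I_(n * n * n) :=
  mxtens_index (mxtens_index (i, j), k).
Definition on_triple (f : 'I_n -> 'I_n -> 'I_n -> 'I_(n * n * n))
    (x : 'I_(n * n * n)) : 'I_(n * n * n) :=
  let: (ij, k) := mxtens_unindex x in
  let: (i, j) := mxtens_unindex ij in f i j k.
Definition swap12 := on_triple (fun i j k => triple j i k).
Definition swap13 := on_triple (fun i j k => triple k j i).
Definition swap23 := on_triple (fun i j k => triple i k j).

Lemma on_tripleE f i j k : on_triple f (triple i j k) = f i j k.
Proof. by rewrite /on_triple /triple !mxtens_indexK. Qed.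

Lemma tripleW (P : 'I_(n * n * n) -> Prop) :
  (forall i j k, P (triple i j k)) -> forall x, P x.
Proof.
move=> Pt x; case: (mxtens_indexP x) => ij k.
by case: (mxtens_indexP ij) => i j; exact: Pt.
Qed.

Lemma triple_eqE i j k i' j' k' :
  (triple i j k == triple i' j' k') = [&& i == i', j == j' & k == k'].
Proof.
by do 2 rewrite (can_eq (@mxtens_indexK _ _)) xpair_eqE; rewrite andbA.
Qed.

Lemma swapE i j : swap (mxtens_index (i, j)) = mxtens_index (j, i).
Proof. by rewrite /swap mxtens_indexK. Qed.
End Swaps.

(** * Permutation matrices and the candidate K-matrix *)

Section Flip.
Variable R : comNzRingType.
(** The permutation matrix of [f] when [f] is bijective. Taking a plain function lets the relations
    between permutations be checked pointwise on triples of indices. *)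
Definition fun_mx n (f : 'I_n -> 'I_n) : 'M[R]_n := rowsub f 1%:M.
Definition flip := @fun_mx (2 * 2) (@swap 2).

Lemma fun_mxE n (f : 'I_n -> 'I_n) i j : fun_mx f i j = (f i == j)%:R.
Proof. by rewrite /fun_mx !mxE. Qed.
Lemma fun_mxM n (f g : 'I_n -> 'I_n) : fun_mx f *m fun_mx g = fun_mx (g \o f).
Proof. by rewrite /fun_mx mul_rowsub_mx mul1mx rowsub_comp. Qed.
Lemma fun_mx_id n (f : 'I_n -> 'I_n) : f =1 id -> fun_mx f = 1%:M.
Proof. by move=> fE; apply/matrixP => i j; rewrite fun_mxE fE !mxE. Qed.
Lemma eq_fun_mx n (f g : 'I_n -> 'I_n) : f =1 g -> fun_mx f = fun_mx g.
Proof. by move=> fE; apply/matrixP => i j; rewrite !fun_mxE fE. Qed.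

(** The entries are polynomial in [u] and [w], so every ring morphism carries this matrix to one of
    the same shape; K(u) and K(v) arise in this way from one matrix. *)
Definition reflection_mx (u w : R) : 'M[R]_(2 * 2) :=
  (u ^+ 2 - w ^+ 2 + 1)%:M - (2 * u) *: flip.
End Flip.

Lemma map_flip (A B : comNzRingType) (f : {rmorphism A -> B}) :
  map_mx f (flip A) = flip B.
Proof. by rewrite /flip /fun_mx map_mxsub map_mx1. Qed.

Lemma map_reflection_mx (A B : comNzRingType) (f : {rmorphism A -> B}) u w :
  map_mx f (reflection_mx u w) = reflection_mx (f u) (f w).
Proof.
rewrite /reflection_mx map_mxD map_mxN map_mxZ map_flip map_scalar_mx.
by rewrite !(rmorphM, rmorphD, rmorphN, rmorphXn, rmorph1, rmorph_nat).
Qed.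

(** * The reflection equation as an identity in the group algebra of S_3 *)

Section ReflectionEquation.
Variable L : fieldType.

(** The entries depend only on equalities between the six indices, and splitting on these settles
    every case. The shape a + b P covers both R and K. *)
Lemma op12_flip a b :
  op12 (a%:M + b *: flip L) = a%:M + b *: fun_mx L (@swap12 2).
Proof.
apply/matrixP; elim/tripleW => i j k; elim/tripleW => i' j' k'.
rewrite op12E !mxE swapE /swap12 on_tripleE !triple_eqE.
rewrite !(can_eq (@mxtens_indexK _ _)) !xpair_eqE.
by do !case: eqP => _ //=; rewrite ?mulr0n ?mulr1n ?mulr0 ?addr0.
Qed.
Lemma op13_flip a b :
  op13 (a%:M + b *: flip L) = a%:M + b *: fun_mx L (@swap13 2).
Proof.
apply/matrixP; elim/tripleW => i j k; elim/tripleW => i' j' k'.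
rewrite op13E !mxE swapE /swap13 on_tripleE !triple_eqE.
rewrite !(can_eq (@mxtens_indexK _ _)) !xpair_eqE.
by do !case: eqP => _ //=; rewrite ?mulr0n ?mulr1n ?mulr0 ?addr0.
Qed.
Lemma op23_flip a b :
  op23 (a%:M + b *: flip L) = a%:M + b *: fun_mx L (@swap23 2).
Proof.
apply/matrixP; elim/tripleW => i j k; elim/tripleW => i' j' k'.
rewrite op23E !mxE swapE /swap23 on_tripleE !triple_eqE.
rewrite !(can_eq (@mxtens_indexK _ _)) !xpair_eqE.
by do !case: eqP => _ //=; rewrite ?mulr0n ?mulr1n ?mulr0 ?addr0.
Qed.

(** With r = z / (z - 1), the corner entries are r + (1 - r) = 1. *)
Lemma Rmat_flip (z : L) :
  Rmat z = (z / (z - 1))%:M + (1 - z / (z - 1)) *: flip L.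
Proof.
apply/matrixP => i j; rewrite !mxE.
case: i => [[|[|[|[|//]]]] ?]; case: j => [[|[|[|[|//]]]] ?];
  by rewrite -!(inj_eq val_inj) /swap /= ?mulr0n ?mulr1n ?mulr0 ?mulr1
    ?addr0 ?add0r // addrC subrK.
Qed.

Lemma reflection_equation_flip (s u v : L) : u - v != 1 -> u + v != 1 ->
  op12 (Rmat (u - v)) *m op13 (reflection_mx u s) *m op12 (Rmat (u + v))
    *m op23 (reflection_mx v s) =
  op23 (reflection_mx v s) *m op12 (Rmat (u + v)) *m op13 (reflection_mx u s)
    *m op12 (Rmat (u - v)).
Proof.
rewrite -(subr_eq0 (u - v)) -(subr_eq0 (u + v)) => uv1 uv2.
rewrite /reflection_mx -!scaleNr !Rmat_flip !op12_flip op13_flip !op23_flip.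
set p := fun_mx L (@swap12 2); set q := fun_mx L (@swap13 2).
set r := fun_mx L (@swap23 2).
have pp : p *m p = 1%:M.
  by rewrite fun_mxM fun_mx_id //;
    elim/tripleW => i j k; rewrite /= /swap12 /swap23 /swap13 !on_tripleE.
have rr : r *m r = 1%:M.
  by rewrite fun_mxM fun_mx_id //;
    elim/tripleW => i j k; rewrite /= /swap12 /swap23 /swap13 !on_tripleE.
have prp : q = p *m r *m p.
  by rewrite !fun_mxM; apply: eq_fun_mx;
    elim/tripleW => i j k; rewrite /= /swap12 /swap23 /swap13 !on_tripleE.
have braid : p *m r *m p = r *m p *m r.
  by rewrite !fun_mxM; apply: eq_fun_mx;
    elim/tripleW => i j k; rewrite /= /swap12 /swap23 /swap13 !on_tripleE.
(* From here on only the relations of S_3 matter, with generators [p] and [r] and with [q] replaced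
   by p r p. *)
clearbody p q r; subst q.
have ppK m (A : 'M_(m, _)) : A *m p *m p = A by rewrite -mulmxA pp mulmx1.
have rrK m (A : 'M_(m, _)) : A *m r *m r = A by rewrite -mulmxA rr mulmx1.
rewrite !(mulmxDl, mulmxDr, mul_scalar_mx, mul_mx_scalar, =^~ scalemxAl, =^~ scalemxAr).
have prpr : p *m r *m p *m r = r *m p by rewrite braid rrK.
(* Every word is brought to one of the normal forms 1, p, r, p r, r p, p r p. *)
rewrite !mulmxA !pp !mul1mx !ppK !prpr -!braid !ppK ?rr ?rrK ?mul1mx.
set c := p *m r; set c' := r *m p; set w := c *m p.
(* In each entry the group elements contribute opaque scalars, so [field] compares their
   coefficients; the denominators are those of R(u - v) and R(u + v). *)
apply/matrixP => i j; rewrite !mxE; case: (i == j); rewrite ?mulr1n ?mulr0n.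
  by field; rewrite uv1 uv2.
by field; rewrite uv1 uv2.
Qed.
End ReflectionEquation.

(** Lets [ring] or [field] deduce one equation from another: only the differences of the two sides
    have to match. *)
Lemma eq_of_sub (V : zmodType) (x y x' y' : V) : x' = y' -> x - y = x' - y' -> x = y.
Proof. by move=> -> /eqP; rewrite subrr subr_eq0 => /eqP. Qed.

Ltac mx4_entry := rewrite !mxE !big_ord_recl !big_ord0 !mxE /=.

(** * Explicit 4 x 4 matrices *)

Section ExplicitMatrices.
Variable L : fieldType.

(** Missing rows and entries are read as 0, so trailing zeros can be omitted in the lists. *)
Definition mx4 (s : seq (seq L)) : 'M[L]_(2 * 2) :=
  \matrix_(i, j) nth 0 (nth [::] s i) j.

(* The matrices that shift the sl(2)-weight by 2 ([b]) or by -2. *)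
Definition step_mx (b : bool) (x1 x2 y1 y2 : L) : 'M[L]_(2 * 2) :=
  mx4 (if b then [:: [:: 0; x1; x2; 0]; [:: 0; 0; 0; y1]; [:: 0; 0; 0; y2]]
       else [:: [::]; [:: x1]; [:: x2]; [:: 0; y1; y2]]).

(* Kept folded so that [ring] treats 1/2 as an atom. *)
Definition one_half : L := 2^-1.

(** The image of [yEtt (-2) b] under the coproduct followed by T_z ⊗ T_w. The entries [sq] move the
    first tensor factor, the entries [lo] the second. *)
Definition Ett_mx (z w : L) (b : bool) : 'M[L]_(2 * 2) :=
  let lo x := w ^+ 2 - x - 3 * one_half ^+ 2 in
  let sq x := (x + one_half) ^+ 2 in
  if b then step_mx b (lo z) (sq z) (sq (- z)) (lo (- z))
  else step_mx b (lo (- z)) (sq (- z)) (sq z) (lo z).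

Definition H_mx : 'M[L]_(2 * 2) := mx4 [:: [:: 2]; [::]; [::]; [:: 0; 0; 0; -2]].

(** Indexing the entries by natural numbers makes them terms such as [f 1 2], which can be rewritten
    once a matrix product is expanded. *)
Lemma mx4_eta (A : 'M[L]_(2 * 2)) :
  exists f : nat -> nat -> L, A = mx4 (mkseq (fun i => mkseq (f i) 4) 4).
Proof.
exists (fun i j => A (@inord 3 i) (@inord 3 j)); apply/matrixP => i j.
by rewrite mxE !nth_mkseq // !inord_val.
Qed.

End ExplicitMatrices.

(** * The action of the Yangian on a tensor product of two evaluation representations *)

Lemma DeltaZ (F : numFieldType) (k : {poly F}) (x : yangian F) :
  Delta (k *: x) = k *: Delta x.
Proof.
rewrite [LHS](lift_scale (sigma := @yy_scal F) (@Delta_compatible F)).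
by rewrite /yy_scal -pscalAl mul1r.
Qed.
Lemma Delta_pgen (F : numFieldType) g :
  Delta (pgen (@yrel F) g) = Delta_gen F g.
Proof. exact: (lift_pgen (sigma := @yy_scal F) (@Delta_compatible F)). Qed.

Section CoproductRep.
Variables (F : numFieldType) (L : fieldType) (iota : {rmorphism F -> L}).
Variables (z w : L).

Definition coprod_rep (x : yangian F) : 'M[L]_(2 * 2) := tens_rep iota z w (Delta x).

Fact coprod_rep_zmod : zmod_morphism coprod_rep.
Proof. by move=> x y; rewrite /coprod_rep !rmorphB. Qed.
Fact coprod_rep_monoid : monoid_morphism coprod_rep.
Proof. by split=> [|x y]; rewrite /coprod_rep ?rmorph1 ?rmorphM. Qed.
HB.instance Definition _ := GRing.isZmodMorphism.Build (yangian F) 'M[L]_(2 * 2)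
  coprod_rep coprod_rep_zmod.
HB.instance Definition _ := GRing.isMonoidMorphism.Build (yangian F) 'M[L]_(2 * 2)
  coprod_rep coprod_rep_monoid.

Lemma tens_repZ k x : tens_rep iota z w (k *: x) = iota k.[1] *: tens_rep iota z w x.
Proof.
by rewrite [LHS](lift_scale (tens_rep_compatible iota z w)) [LHS]mul_scalar_mx.
Qed.

Lemma coprod_repZ k x : coprod_rep (k *: x) = iota k.[1] *: coprod_rep x.
Proof. by rewrite /coprod_rep DeltaZ tens_repZ. Qed.

Lemma tens_rep1l (b : yangian F) :
  tens_rep iota z w (1 ⊗ b) = 1%:M *t eval_rep iota w b.
Proof. by rewrite tens_repE rmorph1. Qed.
Lemma tens_rep1r (a : yangian F) :
  tens_rep iota z w (a ⊗ 1) = eval_rep iota z a *t 1%:M.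
Proof. by rewrite tens_repE rmorph1. Qed.
Lemma eval_rep_pgen x g : eval_rep iota x (pgen (@yrel F) g) = eval_rep_gen x g.
Proof. exact: (lift_pgen (eval_rep_compatible iota x)). Qed.

Lemma coprod_rep_E b :
  coprod_rep (yE F b) = repE L b *t 1%:M + 1%:M *t repE L b.
Proof.
rewrite /coprod_rep Delta_pgen /=.
by rewrite rmorphD /= tens_rep1l tens_rep1r !eval_rep_pgen.
Qed.
Lemma coprod_rep_H :
  coprod_rep (yH F) = repH L *t 1%:M + 1%:M *t repH L.
Proof.
rewrite /coprod_rep Delta_pgen /=.
by rewrite rmorphD /= tens_rep1l tens_rep1r !eval_rep_pgen.
Qed.
Lemma coprod_rep_Hh :
  coprod_rep (yHh F) = (z *: repH L) *t 1%:M + 1%:M *t (w *: repH L) -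
    (repE L true *t repE L false - repE L false *t repE L true).
Proof.
rewrite /coprod_rep Delta_pgen /=.
rewrite rmorphB rmorphD /= tens_rep1l tens_rep1r tens_repZ rmorphB /= !tens_repE !eval_rep_pgen.
by rewrite /= hornerX (rmorph1 iota) scale1r.
Qed.
Lemma coprod_rep_Eh b :
  coprod_rep (yEh F b) = (z *: repE L b) *t 1%:M + 1%:M *t (w *: repE L b) +
    (sg L b / 2) *: (repE L b *t repH L - repH L *t repE L b).
Proof.
rewrite /coprod_rep Delta_pgen /=.
rewrite !rmorphD /= tens_rep1l tens_rep1r tens_repZ rmorphB /= !tens_repE !eval_rep_pgen.
rewrite /= hornerM hornerX hornerC mulr1 rmorphM fmorphV rmorph_nat.
by case: b; rewrite /= ?(rmorphN1 iota) ?(rmorph1 iota).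
Qed.

Lemma coprod_rep_Ett t b :
  coprod_rep (yEtt t b) = (sg L b / 2) *:
   (coprod_rep (yHh F) *m coprod_rep (yEh F b) - coprod_rep (yEh F b) *m coprod_rep (yHh F)
   + ((sg L b * iota t) *: coprod_rep (yEh F b) + coprod_rep (yH F) *m coprod_rep (yEh F b)
     - coprod_rep (yE F b) *m coprod_rep (yHh F))).
Proof.
have s1 : iota (sg F b) = sg L b by case: b; rewrite /= ?rmorphN rmorph1.
rewrite /yEtt coprod_repZ hornerC rmorphM fmorphV rmorph_nat s1.
rewrite rmorphD /comm_of rmorphB !rmorphM /= coprod_repZ hornerX (rmorph1 iota) scale1r.
by rewrite rmorphB rmorphD /= coprod_repZ hornerM !hornerC !rmorphM s1.
Qed.

Lemma coprod_rep_E_mx b : coprod_rep (yE F b) = step_mx b 1 1 1 1.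
Proof.
rewrite coprod_rep_E; apply/matrixP.
by case: b => -[[|[|[|[|//]]]] hi] [[|[|[|[|//]]]] hj];
  rewrite !mxE /= -?val_eqE /=; ring.
Qed.
Lemma coprod_rep_H_mx : coprod_rep (yH F) = H_mx L.
Proof.
rewrite coprod_rep_H; apply/matrixP.
by move=> -[[|[|[|[|//]]]] hi] [[|[|[|[|//]]]] hj];
  rewrite !mxE /=; ring.
Qed.
Lemma coprod_rep_Hh_mx : coprod_rep (yHh F) =
  mx4 [:: [:: z + w]; [:: 0; z - w; -1]; [:: 0; 1; w - z]; [:: 0; 0; 0; - z - w]].
Proof.
rewrite coprod_rep_Hh; apply/matrixP.
by move=> -[[|[|[|[|//]]]] hi] [[|[|[|[|//]]]] hj];
  rewrite !mxE /=; ring.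
Qed.
Lemma coprod_rep_Eh_mx b : coprod_rep (yEh F b) =
  if b then step_mx b (w - one_half L) (z + one_half L) (z - one_half L) (w + one_half L)
  else step_mx b (w + one_half L) (z - one_half L) (z + one_half L) (w - one_half L).
Proof.
rewrite coprod_rep_Eh -/(one_half L); apply/matrixP.
by case: b => -[[|[|[|[|//]]]] hi] [[|[|[|[|//]]]] hj];
  rewrite !mxE /=; ring.
Qed.
(** The value t = -2 enters here: a general t would add (t + 2) / 2 times the image of [yEh F b]. *)
Lemma coprod_rep_Ett_mx b : 2 != 0 :> L ->
  coprod_rep (yEtt (-2) b) = Ett_mx z w b.
Proof.
move=> n2; rewrite coprod_rep_Ett coprod_rep_E_mx coprod_rep_H_mx.
rewrite coprod_rep_Hh_mx coprod_rep_Eh_mx rmorphN rmorph_nat -/(one_half L).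
apply/matrixP.
by case: b => -[[|[|[|[|//]]]] hi] [[|[|[|[|//]]]] hj];
  mx4_entry; rewrite /one_half; field.
Qed.
End CoproductRep.

(** * Solving the intertwining equations on generators *)

Section Intertwiners.
Variable L : fieldType.

Lemma reflection_mxE (u w : L) (a := u ^+ 2 - w ^+ 2 + 1) (b := - (2 * u)) :
  reflection_mx u w = mx4 [:: [:: a + b]; [:: 0; a; b]; [:: 0; b; a]; [:: 0; 0; 0; a + b]].
Proof.
apply/matrixP.
by move=> -[[|[|[|[|//]]]] hi] [[|[|[|[|//]]]] hj];
  rewrite !mxE -!(inj_eq val_inj) /swap /= ?mulr1n ?mulr0n /a /b; ring.
Qed.

Lemma reflection_mx_H u w : H_mx L *m reflection_mx u w = reflection_mx u w *m H_mx L.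
Proof.
rewrite reflection_mxE; apply/matrixP.
by move=> -[[|[|[|[|//]]]] hi] [[|[|[|[|//]]]] hj];
  mx4_entry; ring.
Qed.

Lemma reflection_mx_E b u w :
  step_mx b (1 : L) 1 1 1 *m reflection_mx u w =
  reflection_mx u w *m step_mx b (1 : L) 1 1 1.
Proof.
rewrite reflection_mxE; apply/matrixP.
by case: b => -[[|[|[|[|//]]]] hi] [[|[|[|[|//]]]] hj];
  mx4_entry; ring.
Qed.

Lemma reflection_mx_Ett b (u w : L) : 2 != 0 :> L ->
  Ett_mx (- u) w b *m reflection_mx u w = reflection_mx u w *m Ett_mx u w b.
Proof.
move=> n2; rewrite reflection_mxE; apply/matrixP.
by case: b => -[[|[|[|[|//]]]] hi] [[|[|[|[|//]]]] hj];
  mx4_entry; rewrite /one_half; field.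
Qed.

(** H kills the entries between different weights, E^+ leaves only [f 1 1] and [f 1 2] free, and one
    entry of the last relation fixes their ratio. *)
Lemma intertwiner_unique (u w : L) (K : 'M[L]_(2 * 2)) : 2 != 0 :> L -> u != 0 ->
  H_mx L *m K = K *m H_mx L ->
  (forall b, step_mx b 1 1 1 1 *m K = K *m step_mx b 1 1 1 1) ->
  Ett_mx (- u) w true *m K = K *m Ett_mx u w true ->
  exists c, K = c *: reflection_mx u w.
Proof.
move=> n2 u0; have [f ->] := mx4_eta K; clear K.
move=> /matrixP eH /(_ true)/matrixP eE /matrixP eT.
pose o k (hk : (k < 2 * 2)%N) := Ordinal hk.
(* In the relation with H, an entry of K is multiplied by a difference of the weights 2, 0, 0, -2.
   Differences of 2 are handled by [weight] and those of 4 by [weight2]; [esym] adjusts the sign. *)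
have weight (x y c : L) : x = y -> x - y = 2 * c -> c = 0.
  by move=> ->; rewrite subrr => /esym/eqP; rewrite mulf_eq0 (negPf n2) => /eqP.
have weight2 (x y c : L) : x = y -> x - y = 2 * (2 * c) -> c = 0.
  move=> h1 h2; apply: (@weight 0 0); rewrite ?subrr //; apply/esym.
  exact: weight h1 h2.
have f01 : f 0 1 = 0.
  have := eH (o 0 isT) (o 1 isT).
  by mx4_entry => h; apply: (weight _ _ _ h); ring.
have f02 : f 0 2 = 0.
  have := eH (o 0 isT) (o 2 isT).
  by mx4_entry => h; apply: (weight _ _ _ h); ring.
have f03 : f 0 3 = 0.
  have := eH (o 0 isT) (o 3 isT).
  by mx4_entry => h; apply: (weight2 _ _ _ h); ring.
have f13 : f 1 3 = 0.
  have := eH (o 1 isT) (o 3 isT).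
  by mx4_entry => h; apply: (weight _ _ _ h); ring.
have f23 : f 2 3 = 0.
  have := eH (o 2 isT) (o 3 isT).
  by mx4_entry => h; apply: (weight _ _ _ h); ring.
have f10 : f 1 0 = 0.
  have := eH (o 1 isT) (o 0 isT).
  by mx4_entry => h; apply: (weight _ _ _ (esym h)); ring.
have f20 : f 2 0 = 0.
  have := eH (o 2 isT) (o 0 isT).
  by mx4_entry => h; apply: (weight _ _ _ (esym h)); ring.
have f30 : f 3 0 = 0.
  have := eH (o 3 isT) (o 0 isT).
  by mx4_entry => h; apply: (weight2 _ _ _ (esym h)); ring.
have f31 : f 3 1 = 0.
  have := eH (o 3 isT) (o 1 isT).
  by mx4_entry => h; apply: (weight _ _ _ (esym h)); ring.
have f32 : f 3 2 = 0.
  have := eH (o 3 isT) (o 2 isT).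
  by mx4_entry => h; apply: (weight _ _ _ (esym h)); ring.
have f00 : f 0 0 = f 1 1 + f 2 1.
  have := eE (o 0 isT) (o 1 isT).
  by mx4_entry => h; apply: (eq_of_sub (esym h)); ring.
have f00' : f 0 0 = f 1 2 + f 2 2.
  have := eE (o 0 isT) (o 2 isT).
  by mx4_entry => h; apply: (eq_of_sub (esym h)); ring.
have f33 : f 3 3 = f 1 1 + f 1 2.
  have := eE (o 1 isT) (o 3 isT).
  by mx4_entry => h; apply: (eq_of_sub h); ring.
have f33' : f 3 3 = f 2 1 + f 2 2.
  have := eE (o 2 isT) (o 3 isT).
  by mx4_entry => h; apply: (eq_of_sub h); ring.
have f21 : f 2 1 = f 1 2.
  apply: subr0_eq.
  (* This is [f 0 0] + [f 3 3] computed in two ways; the two sides differ by 2 (f 2 1 - f 1 2). *)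
  have h : (f 1 1 + f 2 1) + (f 2 1 + f 2 2) = (f 1 2 + f 2 2) + (f 1 1 + f 1 2).
    by rewrite -f00 -f33' f00' f33.
  by apply: (weight _ _ _ h); ring.
have f22 : f 2 2 = f 1 1.
  by apply: (addrI (f 1 2)); rewrite -f00' f00 f21 addrC.
(* The linear condition on a = [f 1 1] and b = [f 1 2]. Its constant 1 is 1/4 from [sq] plus 3/4
   from [lo]. *)
have rel : 2 * u * f 1 1 + (u ^+ 2 - w ^+ 2 + 1) * f 1 2 = 0.
  have := eT (o 0 isT) (o 1 isT).
  mx4_entry; rewrite f21 f01 f31 f00 f21 => h.
  by apply: (eq_of_sub h); rewrite /one_half; field.
have f11 : f 1 1 = - (f 1 2 / (2 * u)) * (u ^+ 2 - w ^+ 2 + 1).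
  have -> : f 1 1 = (2 * u * f 1 1) / (2 * u) by field; rewrite n2 u0.
  by move/eqP: rel; rewrite addr_eq0 => /eqP ->; field; rewrite n2 u0.
(* The scalar is forced by entry (1, 2), which is - 2 u in [reflection_mx u w]. *)
exists (- (f 1 2 / (2 * u))).
rewrite reflection_mxE; apply/matrixP.
by move=> -[[|[|[|[|//]]]] hi] [[|[|[|[|//]]]] hj];
  rewrite !mxE /= ?f01 ?f02 ?f03 ?f10 ?f13 ?f20 ?f23 ?f30 ?f31 ?f32 ?f33 ?f00 ?f21 ?f22 ?f11;
  rewrite ?mulr0 //; field; rewrite n2 u0.
Qed.
End Intertwiners.

(** * Evaluation of rational functions at transcendental elements *)

Definition transcendental (F G : fieldType) (f : {rmorphism F -> G}) (z : G) :=
  forall p : {poly F}, p != 0 -> ~~ root (map_poly f p) z.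

(** Morphisms of fields are injective, so they create no new roots. *)
Lemma transcendental_comp (F G H : fieldType) (f : {rmorphism F -> G})
    (g : {rmorphism G -> H}) z :
  transcendental f z -> transcendental (g \o f) (g z).
Proof. by move=> tr p p0; rewrite map_poly_comp fmorph_root tr. Qed.

(** Evaluating at the variable gives back the polynomial itself, seen in the fraction field. *)
Lemma transcendental_X (F G : fieldType) (f : {rmorphism F -> G}) :
  transcendental ((tofrac \o polyC) \o f) ('X%:F).
Proof.
move=> p p0; rewrite map_poly_comp map_poly_comp /root horner_map /=.
by rewrite -/(comp_poly _ _) comp_polyXr tofrac_eq0 map_poly_eq0.
Qed.

(** As [ratfun_eval] uses a chosen representative of a fraction, each polynomial entry p is written
    as p / 1, where [ratfun_evalE] gives its value. *)
Lemma map_ratfun_eval (F : numFieldType) (L : fieldType) (f : {rmorphism F -> L})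
   (z : L) (M : 'M[{poly F}]_(2 * 2)) : transcendental f z ->
  map_mx (ratfun_eval f z) (map_mx tofrac M) =
  map_mx (horner_eval z \o map_poly f) M.
Proof.
move=> tr; apply/matrixP => i j; rewrite !mxE /=.
rewrite -[(M i j)%:F]divr1 -tofrac1 ratfun_evalE ?oner_neq0 //.
by rewrite rmorph1 hornerC divr1.
Qed.

Lemma reflection_mx_ratfun_eval (F : numFieldType) (L : fieldType)
    (f : {rmorphism F -> L}) (z : L) (s : F) : transcendental f z ->
  map_mx (ratfun_eval f z) (reflection_mx 'X%:F s%:P%:F) = reflection_mx z (f s).
Proof.
move=> tr; rewrite -map_reflection_mx map_ratfun_eval // map_reflection_mx /=.
by rewrite /horner_eval map_polyX map_polyC hornerX hornerC.
Qed.

(** * Intertwiners for the whole twisted Yangian *)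

Section Intertwines.
Variables (F : numFieldType) (L : fieldType) (iota : {rmorphism F -> L}).

(** The condition is stable under sums, products and scalars, so for multiples of [reflection_mx] it
    need only be checked on generators; conversely, the generators already force this shape by
    [intertwiner_unique]. *)
Lemma intertwinesP (s : F) (u : L) (K : 'M[L]_(2 * 2)) : u != 0 ->
  (forall b, twisted_yangian (-2) b ->
     coprod_rep iota (- u) (iota s) b *m K = K *m coprod_rep iota u (iota s) b) <->
  exists c, K = c *: reflection_mx u (iota s).
Proof.
move=> u0; have n2 : 2 != 0 :> L by rewrite -(rmorph_nat iota) fmorph_eq0 pnatr_eq0.
have repEtt z b : coprod_rep iota z (iota s) (yEtt (-2) b) = Ett_mx z (iota s) b.
  by rewrite coprod_rep_Ett_mx.
have sum (A B C D X : 'M[L]_(2 * 2)) : A *m X = X *m B -> C *m X = X *m D ->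
    (A + C) *m X = X *m (B + D).
  by move=> AB CD; rewrite mulmxDl mulmxDr AB CD.
have diff (A B C D X : 'M[L]_(2 * 2)) : A *m X = X *m B -> C *m X = X *m D ->
    (A - C) *m X = X *m (B - D).
  by move=> AB CD; rewrite mulmxBl mulmxBr AB CD.
have prod (A B C D X : 'M[L]_(2 * 2)) : A *m X = X *m B -> C *m X = X *m D ->
    (A *m C) *m X = X *m (B *m D).
  by move=> AB CD; rewrite -mulmxA CD mulmxA AB mulmxA.
split=> [KP|[c ->] b tb].
  apply: (intertwiner_unique n2 u0).
  - by have := KP _ (ty_H _); rewrite !coprod_rep_H_mx.
  - by move=> b; have := KP _ (ty_E _ b); rewrite !coprod_rep_E_mx.
  - by have := KP _ (ty_Ett _ true); rewrite !repEtt.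
rewrite -scalemxAl -scalemxAr; congr (_ *: _).
set K0 := reflection_mx _ _.
have KE b' : coprod_rep iota (- u) (iota s) (yE F b') *m K0 =
    K0 *m coprod_rep iota u (iota s) (yE F b').
  rewrite !coprod_rep_E_mx; exact: reflection_mx_E.
have KEtt b' : coprod_rep iota (- u) (iota s) (yEtt (-2) b') *m K0 =
    K0 *m coprod_rep iota u (iota s) (yEtt (-2) b').
  rewrite !repEtt; exact: reflection_mx_Ett.
elim: tb => [b'||b'||k|x y _ IHx _ IHy|x y _ IHx _ IHy] //.
- by rewrite !coprod_rep_H_mx reflection_mx_H.
- by rewrite /yHtt /comm_of !rmorphB !rmorphM /=; apply: diff; apply: prod.
- rewrite !coprod_repZ !rmorph1 -scalemxAl -scalemxAr.
  by rewrite [_ *m _]mul1mx [_ *m _]mulmx1.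
- by rewrite !rmorphD /=; apply: sum.
- by rewrite !rmorphM /=; apply: prod.
Qed.
End Intertwines.

(** The coefficient of degree 1 is [c]. This serves for u - v - 1 and u + v - 1, seen as polynomials
    in v over F(u). *)
Lemma linear_neq0 (R : idomainType) (a b c : R) :
  c != 0 -> a%:P + c *: 'X - b%:P != 0.
Proof.
move=> c0; apply: contraNneq c0 => /(congr1 (fun p : {poly R} => p`_1)).
by rewrite coefB coefD coefZ coefX !coefC /= subr0 add0r mulr1 => ->.
Qed.

(** * Assembly over the fields F(u) and F(u)(v) *)

Theorem reflection_algebra (F : numFieldType) (s : F) :
  exists K : 'M[ratfun F]_(2 * 2),
    [/\ K != 0,
        forall K' : 'M[ratfun F]_(2 * 2),
          intertwines (-2) s K' <-> exists c : ratfun F, K' = c *: K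
      & reflection_equation K].
Proof.
have u0 : 'X%:F != 0 :> ratfun F by rewrite tofrac_eq0 polyX_eq0.
exists (reflection_mx 'X%:F s%:P%:F); split.
(* Entry (1, 2) is - 2 u, which is nonzero in characteristic 0. *)
- pose o k (hk : (k < 2 * 2)%N) := Ordinal hk.
  apply/eqP => /matrixP/(_ (o 1 isT) (o 2 isT)).
  rewrite reflection_mxE !mxE /= => /eqP.
  rewrite oppr_eq0 mulf_eq0 (negPf u0) orbF.
  by rewrite -(rmorph_nat (tofrac \o polyC : {rmorphism F -> ratfun F})) fmorph_eq0 pnatr_eq0.
- move=> K'.
  exact: (@intertwinesP F (ratfun F) (tofrac \o polyC) s 'X%:F K' u0).
rewrite /reflection_equation.
set G := ratfun F; set L := ratfun G.
pose f : {rmorphism F -> G} := tofrac \o polyC.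
pose g : {rmorphism G -> L} := tofrac \o polyC.
(* Over F, u is transcendental already in F(u) and stays so in F(u)(v); v is the outer variable. *)
have tu : transcendental (g \o f) ('X%:F)%:P%:F.
  apply: (@transcendental_comp _ _ _ f g); exact: (@transcendental_X F F idfun).
have tv : transcendental (g \o f) 'X%:F by exact: (@transcendental_X F G f).
rewrite (reflection_mx_ratfun_eval s tu) (reflection_mx_ratfun_eval s tv).
(* It remains to see that u - v and u + v avoid the pole of R at 1. *)
apply: reflection_equation_flip; rewrite -subr_eq0 -tofrac1.
- rewrite -!tofracB tofrac_eq0 -scaleN1r.
  by apply: linear_neq0; rewrite oppr_eq0 oner_neq0.
- rewrite -tofracD -tofracB tofrac_eq0 -[X in _ + X - _]scale1r.
  by apply: linear_neq0; rewrite oner_neq0.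
Qed.

Theorem proposition3p6 (R : realType) (s : R[i]) :
  exists K : 'M[ratfun R[i]]_(2 * 2),
    [/\ K != 0,
        forall K' : 'M[ratfun R[i]]_(2 * 2),
          intertwines (-2) s K' <-> exists c : ratfun R[i], K' = c *: K
      & reflection_equation K].
Proof. exact: reflection_algebra. Qed.
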